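(* Let $m\le n$, $a>0$, $\lambda>0$, let $\mathcal{A}:\mathbb{R}^{m\times n}\to\mathbb{R}^d$ be a linear map with matrix $A\in\mathbb{R}^{d\times mn}$ (so $\mathcal{A}(X)=A\,\mathrm{vec}(X)$), and let $b\in\mathbb{R}^d$. Let $X^*$ be an optimal solution of $$\min_{X\in\mathbb{R}^{m\times n}}\Big\{\|\mathcal{A}(X)-b\|_2^2+\lambda P(X)\Big\},$$ and let $\mathrm{rank}(X^* )=r$. Then the following hold. (1) If $\lambda>\|b\|_2^2$, then $$\|\sigma(X^* )\|_\infty\le\frac{\|b\|_2^2}{a(\lambda-\|b\|_2^2)}.$$ (2) Let $$\bar\lambda=\|b\|_2^2+\frac{\|A^Tb\|_2+\sqrt{\|A^Tb\|_2^2+2a\|b\|_2^2\|A^Tb\|_2}}{a}.$$ Then, whenever $\lambda\ge\bar\lambda$, one has $X^*=0$.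
   Context: For $a>0$, $\rho_a(t)=\frac{a|t|}{a|t|+1}$ for $t\in\mathbb{R}$, and for $X\in\mathbb{R}^{m\times n}$ with $m\le n$, $P(X)=\sum_{i=1}^m\rho_a(\sigma_i(X))$, where $\sigma_1(X)\ge\cdots\ge\sigma_m(X)\ge0$ are the singular values of $X$ and $\sigma(X)=(\sigma_1(X),\dots,\sigma_m(X))$ is the vector of singular values. $\|\cdot\|_\infty$ is the maximum norm of a vector and $\|\cdot\|_2$ the Euclidean norm. $\mathrm{vec}(X)\in\mathbb{R}^{mn}$ is the column-stacking vectorization of $X$. *)

(* Defs.v *)
From mathcomp Require Export all_boot all_order all_algebra.
From mathcomp Require Export polyrcf.
From mathcomp Require Export reals topology normedtype.

Set Implicit Arguments.
Unset Strict Implicit.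
Unset Printing Implicit Defensive.

Export Order.TTheory GRing.Theory Num.Theory.
Export numFieldNormedType.Exports.

Local Open Scope ring_scope.

(* [mxvec] is row-major, so the column-stacking vectorization of X is obtained
   from X^T; its dimension then reads n * m instead of m * n. *)
Definition vec (R : realType) (m n : nat) (X : 'M[R]_(m, n)) : 'cV[R]_(n * m) :=
  (mxvec X^T)^T.

Definition norm2 (R : realType) (d : nat) (v : 'cV[R]_d) : R :=
  Num.sqrt (\sum_(i < d) v i 0 ^+ 2).

(* [rootsR] lists each real root once, hence the repetition by [mup]. *)
Definition eigenvalues (R : realType) (m : nat) (S : 'M[R]_m) : seq R :=
  let p := char_poly S in
  sort >=%R (flatten [seq nseq (mup x p) x | x <- rootsR p]).

(* For m <= n: the square roots of the eigenvalues of the m x m matrix X X^T,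
   counted with multiplicity, in nonincreasing order. As X X^T is symmetric it
   has exactly m real eigenvalues, so the default value of [nth] is not used. *)
Definition sigma (R : realType) (m n : nat) (X : 'M[R]_(m, n)) : 'rV[R]_m :=
  \row_(i < m) Num.sqrt (nth 0 (eigenvalues (X *m X^T)) i).

Definition rho (R : realType) (a t : R) : R := a * `|t| / (a * `|t| + 1).

Definition P (R : realType) (m n : nat) (a : R) (X : 'M[R]_(m, n)) : R :=
  \sum_(i < m) rho a (sigma X 0 i).

Definition objective (R : realType) (m n d : nat) (a lambda : R)
    (calA : 'M[R]_(m, n) -> 'cV[R]_d) (b : 'cV[R]_d) (X : 'M[R]_(m, n)) : R :=
  norm2 (calA X - b) ^+ 2 + lambda * P a X.

(* Main.v *)
(* Comparing the minimizer X' with X = 0 gives, with B = |b|^2 and c = |A^T b|, both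
   lambda P(X') <= B and |A(X')|^2 + lambda P(X') <= 2 <A(X'), b>.
   The first bounds each rho (sigma_i), which is part (1) after clearing
   denominators.  For part (2), the same bound gives
   lambda rho (sigma_i) >= a (lambda - B) sigma_i, and lambda >= lambda_bar
   gives a (lambda - B) >= 2 c.  Since |X'|_F <= sum_i sigma_i, Cauchy-Schwarz
   yields 2 <A(X'), b> <= 2 c |X'|_F <= lambda P(X'), so A(X') = 0; then
   lambda P(X') <= 0 and X' = 0.
   The only spectral fact needed is that the eigenvalues of X X^T sum to its
   trace: its characteristic polynomial splits over R because complex
   eigenvalues of a hermitian matrix are real. *)
Require Import Defs.
From mathcomp Require Import mxpoly spectral complex ring lra.

Set Implicit Arguments.
Unset Strict Implicit.
Unset Printing Implicit Defensive.

Local Open Scope ring_scope.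

(** * Eigenvalues of symmetric matrices *)

Lemma count_mem_flatten_nseq (T : eqType) (f : T -> nat) (s : seq T) (x : T) :
  uniq s ->
  count_mem x (flatten [seq nseq (f y) y | y <- s]) = ((x \in s) * f x)%N.
Proof.
elim: s => [|y s IHs] //= /andP[ys us].
rewrite count_cat count_nseq IHs // inE /= (eq_sym x).
by case: eqVneq => [<-|] //=; rewrite (negPf ys) addn0.
Qed.

Lemma mup_prod_XsubC (F : fieldType) (s : seq F) (x : F) :
  mup x (\prod_(y <- s) ('X - y%:P)) = count_mem x s.
Proof.
elim: s => [|y s IHs]; first by rewrite big_nil mupNroot // root1.
rewrite big_cons mupM ?polyXsubC_eq0 ?monic_neq0 ?monic_prod_XsubC //.
by rewrite IHs -['X - _]expr1 mup_XsubCX /=; case: eqP.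
Qed.

(** Both lists repeat each value as often as its multiplicity as a root of the characteristic
    polynomial, so any splitting of it determines [eigenvalues S] up to order. *)
Lemma perm_eigenvalues (R : realType) (m : nat) (S : 'M[R]_m) (s : seq R) :
  char_poly S = \prod_(x <- s) ('X - x%:P) -> perm_eq (eigenvalues S) s.
Proof.
move=> pE; rewrite /eigenvalues pE perm_sort.
have p0 : \prod_(x <- s) ('X - x%:P) != 0 by rewrite monic_neq0 ?monic_prod_XsubC.
apply/allP => x _ /=; rewrite count_mem_flatten_nseq ?uniq_roots //.
rewrite -roots_on_rootsR // root_prod_XsubC mup_prod_XsubC in_itv /=.
by case: (boolP (x \in s)) => [_|/count_memPn ->]; rewrite ?mul1n ?muln0.
Qed.

(** Diagonalize S as Q^-1 D Q with D real. A left eigenvector v of S becomes a nonzero w = v Q^-1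
    with w D = z w, and any nonzero entry of w identifies z with a diagonal entry of D. *)
Lemma eigenvalue_hermsym_real (C : numClosedFieldType) (m : nat) (S : 'M[C]_m)
    (z : C) :
  S \is hermsymmx -> eigenvalue S z -> z \is Num.real.
Proof.
move=> Sh; have /orthomx_spectralP SE := hermitian_normalmx Sh.
have dr := hermitian_spectral_diag_real Sh.
case/eigenvalueP => v; rewrite SE => vS v0.
set Q := spectralmx S in vS; have Qu : Q \in unitmx := spectral_unit S.
set D := spectral_diag S in vS dr.
have wD : v *m invmx Q *m diag_mx D = z *: (v *m invmx Q).
  by rewrite scalemxAl -vS !mulmxA mulmxK.
have [i wi] : exists i, (v *m invmx Q) 0 i != 0.
  apply/rV0Pn; apply: contra_neq v0 => w0.
  by rewrite -[v](mulmxKV Qu) w0 mul0mx.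
move/rowP/(_ i): wD; rewrite mul_mx_diag mxE [RHS]mxE mulrC => /(mulIf wi) <-.
exact: (mxOverP dr).
Qed.

(** Split over R[i]: the roots are real there, so taking real parts loses nothing, and the
    factorization descends because the embedding is injective on polynomials. *)
Lemma char_poly_sym_split (R : rcfType) (m : nat) (S : 'M[R]_m) :
  S^T = S -> exists s : seq R, char_poly S = \prod_(x <- s) ('X - x%:P).
Proof.
move=> Ssym; pose f := real_complex R.
have Sr : map_mx f S \is a mxOver Num.real.
  by apply/mxOverP => i j; rewrite mxE complex_real.
have Sh : map_mx f S \is hermsymmx.
  apply: realsym_hermsym => //.
  by apply/is_hermitianmxP; rewrite expr0 scale1r map_mx_id // map_trmx Ssym.
have [s sE] := closed_field_poly_normal (char_poly (map_mx f S)).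
rewrite (monicP (char_poly_monic _)) scale1r in sE.
exists [seq complex.Re z | z <- s]; apply: (@map_poly_inj _ _ f).
rewrite map_char_poly sE rmorph_prod big_map; apply: eq_big_seq => z zs.
rewrite rmorphB /= map_polyX map_polyC /= RRe_real //.
apply: eigenvalue_hermsym_real Sh _.
by rewrite eigenvalue_root_char sE root_prod_XsubC.
Qed.

Lemma sum_eigenvalues (R : realType) (m : nat) (S : 'M[R]_m) :
  S^T = S -> \sum_(i < m) (eigenvalues S)`_i = \tr S.
Proof.
move=> Ssym; have [s pE] := char_poly_sym_split Ssym.
have sz : size s = m.
  by apply/succn_inj; rewrite -(size_prod_XsubC s id) -pE size_char_poly.
have ps := perm_eigenvalues pE.
rewrite -(big_mkord xpredT (nth 0 (eigenvalues S))) -[X in \sum_(0 <= _ < X) _]sz.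
rewrite -(perm_size ps) -(big_nth 0 xpredT id) (perm_big _ ps) /=.
(* Vieta compares the coefficients of degree m - 1, which needs m > 0. *)
case: m => [|m] in S Ssym pE sz ps *.
  by rewrite (size0nil sz) big_nil /mxtrace big_ord0.
have := @coefPn_prod_XsubC R s; rewrite -pE sz char_poly_trace //.
by move=> /(_ isT) /oppr_inj.
Qed.

Lemma sigma_ge0 (R : realType) (m n : nat) (X : 'M[R]_(m, n)) (i : 'I_m) :
  0 <= sigma X 0 i.
Proof. by rewrite mxE sqrtr_ge0. Qed.

Lemma sigma0 (R : realType) (m n : nat) : sigma (0 : 'M[R]_(m, n)) = 0.
Proof.
apply/rowP => i; rewrite !mxE mul0mx.
have -> : (eigenvalues (0 : 'M[R]_m))`_i = 0; last by rewrite sqrtr0.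
(* Beyond the end of the list [nth] returns 0 as well, so the list's length need not be known. *)
have [lt_i|] := ltnP i (size (eigenvalues (0 : 'M[R]_m))); last exact: nth_default.
have := mem_nth 0 lt_i; move: (nth _ _ _) => x.
rewrite mem_sort => /flatten_mapP[y].
rewrite -roots_on_rootsR ?monic_neq0 ?char_poly_monic //.
move=> /andP[_ y_root] /nseqP[-> _]; move: y_root; rewrite -eigenvalue_root_char.
case/eigenvalueP => v /eqP; rewrite mulmx0 eq_sym scaler_eq0.
by case/orP => [/eqP //|/eqP ->]; rewrite eqxx.
Qed.

(** * Euclidean norm, vectorization and singular values *)

Lemma norm2_ge0 (R : realType) (d : nat) (v : 'cV[R]_d) : 0 <= norm2 v.
Proof. exact: sqrtr_ge0. Qed.

Lemma sqr_norm2 (R : realType) (d : nat) (v : 'cV[R]_d) :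
  norm2 v ^+ 2 = \sum_(i < d) v i 0 ^+ 2.
Proof. by rewrite sqr_sqrtr // sumr_ge0 // => i _; rewrite sqr_ge0. Qed.

Lemma norm2_eq0 (R : realType) (d : nat) (v : 'cV[R]_d) : norm2 v = 0 -> v = 0.
Proof.
move=> v0; have : norm2 v ^+ 2 = 0 by rewrite v0 expr0n.
rewrite sqr_norm2 => /psumr_eq0P vi0; apply/colP => i; rewrite mxE.
by apply/eqP; rewrite -sqrf_eq0; apply/eqP/vi0 => // j _; rewrite sqr_ge0.
Qed.

Lemma sqr_norm2B (R : realType) (d : nat) (u v : 'cV[R]_d) :
  norm2 (u - v) ^+ 2 =
    norm2 u ^+ 2 - 2 * (\sum_(i < d) u i 0 * v i 0) + norm2 v ^+ 2.
Proof.
rewrite !sqr_norm2 mulr_sumr -sumrB -big_split /=.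
by apply: eq_bigr => i _; rewrite !mxE; ring.
Qed.

Lemma cauchy_schwarz_norm2 (R : realType) (d : nat) (u v : 'cV[R]_d) :
  \sum_(i < d) u i 0 * v i 0 <= norm2 u * norm2 v.
Proof.
have [/norm2_eq0 ->|u0] := eqVneq (norm2 u) 0.
  by rewrite big1 ?mulr_ge0 ?norm2_ge0 // => i _; rewrite mxE mul0r.
have [/norm2_eq0 ->|v0] := eqVneq (norm2 v) 0.
  by rewrite big1 ?mulr_ge0 ?norm2_ge0 // => i _; rewrite mxE mulr0.
have c0 : 0 < norm2 u * norm2 v by rewrite mulr_gt0 // lt_def norm2_ge0 ?u0 ?v0.
(* Rescaling u and v to equal length makes this square a positive multiple of the desired
   difference. *)
have : 0 <= norm2 (norm2 v *: u - norm2 u *: v) ^+ 2 by rewrite sqr_ge0.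
have -> : norm2 (norm2 v *: u - norm2 u *: v) ^+ 2 =
    2 * (norm2 u * norm2 v) * (norm2 u * norm2 v - \sum_(i < d) u i 0 * v i 0).
  rewrite sqr_norm2B !sqr_norm2.
  under eq_bigr do rewrite mxE exprMn.
  under [X in _ - 2 * X]eq_bigr do rewrite !mxE mulrACA.
  under [X in _ + X]eq_bigr do rewrite mxE exprMn.
  by rewrite -!mulr_sumr -!sqr_norm2; ring.
by rewrite pmulr_rge0 ?subr_ge0 // mulr_gt0.
Qed.

Lemma sqr_norm2_vec (R : realType) (m n : nat) (X : 'M[R]_(m, n)) :
  norm2 (vec X) ^+ 2 = \tr (X *m X^T).
Proof.
rewrite sqr_norm2 (reindex _ (curry_mxvec_bij n m)) /=.
under [RHS]eq_bigr do rewrite mxE.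
rewrite exchange_big pair_bigA /=; apply: eq_bigr => -[j i] _ /=.
by rewrite mxE mxvecE !mxE.
Qed.

(* Only [<=] is claimed because [sqrtr] truncates negative eigenvalues to 0;
   this spares a proof that X X^T is positive semidefinite. *)
Lemma mxtrace_le_sum_sqr_sigma (R : realType) (m n : nat) (X : 'M[R]_(m, n)) :
  \tr (X *m X^T) <= \sum_(i < m) sigma X 0 i ^+ 2.
Proof.
rewrite -sum_eigenvalues ?trmx_mul ?trmxK //; apply: ler_sum => i _; rewrite mxE.
have [e0|e0] := leP 0 (nth 0 (eigenvalues (X *m X^T)) i); first by rewrite sqr_sqrtr.
by rewrite (le_trans (ltW e0)) ?sqr_ge0.
Qed.

(** Frobenius norm against nuclear norm: for nonnegative numbers, the sum of squares is at most the
    square of the sum. *)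
Lemma norm2_vec_le_sum_sigma (R : realType) (m n : nat) (X : 'M[R]_(m, n)) :
  norm2 (vec X) <= \sum_(i < m) sigma X 0 i.
Proof.
have s0 : 0 <= \sum_(i < m) sigma X 0 i by apply: sumr_ge0 => i _; exact: sigma_ge0.
rewrite -(@ler_pXn2r _ 2) ?nnegrE ?norm2_ge0 // sqr_norm2_vec.
apply: le_trans (mxtrace_le_sum_sqr_sigma X) _.
rewrite [leRHS]expr2 mulr_sumr; apply: ler_sum => i _.
rewrite expr2 ler_wpM2r ?sigma_ge0 // (bigD1 i) //= lerDl.
by apply: sumr_ge0 => j _; exact: sigma_ge0.
Qed.

Lemma vec_eq0 (R : realType) (m n : nat) (X : 'M[R]_(m, n)) : vec X = 0 -> X = 0.
Proof.
by move/eqP; rewrite /vec trmx_eq0 mxvec_eq0 trmx_eq0 => /eqP.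
Qed.

Lemma adjoint_dot (R : realType) (d k : nat) (A : 'M[R]_(d, k)) (x : 'cV[R]_k)
    (b : 'cV[R]_d) :
  \sum_(i < d) (A *m x) i 0 * b i 0 = \sum_(j < k) (A^T *m b) j 0 * x j 0.
Proof.
have dotE p (u v : 'cV[R]_p) : \sum_(i < p) u i 0 * v i 0 = (u^T *m v) 0 0.
  by rewrite mxE; apply: eq_bigr => i _; rewrite mxE.
under [RHS]eq_bigr do rewrite mulrC.
by rewrite !dotE trmx_mul mulmxA.
Qed.

(** * The penalty and its linear bounds *)

Lemma rho_ge0 (R : realType) (a t : R) : 0 <= a -> 0 <= rho a t.
Proof. by move=> a0; rewrite divr_ge0 // ?addr_ge0 ?mulr_ge0. Qed.

Lemma P_ge0 (R : realType) (m n : nat) (a : R) (X : 'M[R]_(m, n)) :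
  0 <= a -> 0 <= P a X.
Proof. by move=> a0; apply: sumr_ge0 => i _; exact: rho_ge0. Qed.

Lemma P0 (R : realType) (m n : nat) (a : R) : P a (0 : 'M[R]_(m, n)) = 0.
Proof.
by rewrite /P sigma0 big1 // => i _; rewrite mxE /rho normr0 mulr0 mul0r.
Qed.

Lemma rho_le_bound (R : realType) (a t lambda B : R) :
  0 < a -> 0 <= t -> lambda * rho a t <= B -> a * t * (lambda - B) <= B.
Proof.
move=> a0 t0; have at0 : 0 <= a * t by rewrite mulr_ge0 // ltW.
rewrite /rho ger0_norm // mulrA ler_pdivrMr ?ltr_wpDl //.
by move=> h; lra.
Qed.

(** The bound of [rho_le_bound] rearranges to (lambda - B)(a t + 1) <= lambda, so c (a t + 1) <= a
    lambda; multiply by t and divide by a t + 1. *)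
Lemma rho_ge_linear (R : realType) (a t lambda B c : R) :
  0 < a -> 0 <= t -> lambda * rho a t <= B -> c <= a * (lambda - B) ->
  c * t <= lambda * rho a t.
Proof.
move=> a0 t0 hB hc; have at0 : 0 <= a * t by rewrite mulr_ge0 // ltW.
have := rho_le_bound a0 t0 hB; rewrite /rho ger0_norm // => h.
rewrite mulrA ler_pdivlMr ?ltr_wpDl //.
have hc' : c * (a * t + 1) <= a * lambda.
  apply: (@le_trans _ _ (a * (lambda - B) * (a * t + 1))).
    by rewrite ler_wpM2r // addr_ge0.
  by rewrite -mulrA ler_wpM2l ?(ltW a0) //; lra.
by have := ler_wpM2r t0 hc'; lra.
Qed.

(* `|sigma Xs| is the library's maximum norm on row vectors. *)
Theorem theorem6 (R : realType) (m n d : nat) (hmn : (m <= n)%N)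
    (a lambda : R) (ha : 0 < a) (hlambda : 0 < lambda)
    (calA : {linear 'M[R]_(m, n) -> 'cV[R]_d}) (A : 'M[R]_(d, n * m))
    (hA : forall X : 'M[R]_(m, n), calA X = A *m vec X)
    (b : 'cV[R]_d) (Xs : 'M[R]_(m, n))
    (hopt : forall X : 'M[R]_(m, n),
        objective a lambda calA b Xs <= objective a lambda calA b X)
    (r : nat) (hr : \rank Xs = r) :
  (norm2 b ^+ 2 < lambda ->
     `|sigma Xs| <= norm2 b ^+ 2 / (a * (lambda - norm2 b ^+ 2))) /\
  (let lambda_bar := norm2 b ^+ 2 +
       (norm2 (A^T *m b) +
        Num.sqrt (norm2 (A^T *m b) ^+ 2 +
                  2 * a * norm2 b ^+ 2 * norm2 (A^T *m b))) / a in
   lambda_bar <= lambda -> Xs = 0).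
Proof.
set B := norm2 b ^+ 2; set c := norm2 (A^T *m b).
have B0 : 0 <= B by rewrite sqr_ge0.
have c0 : 0 <= c by exact: norm2_ge0.
have a_ge0 := ltW ha.
have hopt0 : norm2 (calA Xs - b) ^+ 2 + lambda * P a Xs <= B.
  have -> : B = objective a lambda calA b 0; last exact: hopt.
  rewrite /objective P0 mulr0 addr0 linear0 sub0r /B !sqr_norm2.
  by under [RHS]eq_bigr do rewrite mxE sqrrN.
have optE : norm2 (calA Xs) ^+ 2 + lambda * P a Xs <=
    2 * (\sum_(j < n * m) (A^T *m b) j 0 * vec Xs j 0).
  by move: hopt0; rewrite sqr_norm2B -adjoint_dot -hA -/B; lra.
have lrhoB i : lambda * rho a (sigma Xs 0 i) <= B.
  have PB : lambda * P a Xs <= B.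
    by apply: le_trans hopt0; rewrite lerDr sqr_ge0.
  apply: le_trans PB; rewrite ler_pM2l // /P (bigD1 i) //= lerDl.
  by apply: sumr_ge0 => j _; exact: rho_ge0.
split=> [ltB|lambda_bar le_lambda].
  have q0 : 0 < a * (lambda - B) by rewrite mulr_gt0 ?subr_gt0.
  rewrite [leLHS]/Num.norm /= mx_normrE.
  (* The maximum starts from 0, so the bound itself must be shown nonnegative. *)
  apply: bigmax_le => [|[k i] _ /=]; first by rewrite divr_ge0 // ltW.
  rewrite (ord1 k) ger0_norm ?sigma_ge0 // ler_pdivlMr //.
  by have := rho_le_bound ha (sigma_ge0 Xs i) (lrhoB i); lra.
have hc : 2 * c <= a * (lambda - B).
  (* Keeping only c ^+ 2 under the root gives c + sqrt(...) >= 2 c. *)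
  have cs : c <= Num.sqrt (c ^+ 2 + 2 * a * B * c).
    rewrite -[leLHS]ger0_norm // -sqrtr_sqr ler_wsqrtr // lerDl.
    by do 3![rewrite mulr_ge0 //].
  have : (c + Num.sqrt (c ^+ 2 + 2 * a * B * c)) / a <= lambda - B.
    by move: le_lambda; rewrite /lambda_bar -/B -/c; lra.
  by rewrite ler_pdivrMr //; lra.
have cX : 2 * (c * norm2 (vec Xs)) <= lambda * P a Xs.
  rewrite mulrA /P mulr_sumr.
  apply: le_trans (_ : \sum_(i < m) 2 * c * sigma Xs 0 i <= _).
    by rewrite -mulr_sumr ler_wpM2l ?mulr_ge0 ?norm2_vec_le_sum_sigma.
  by apply: ler_sum => i _; exact: rho_ge_linear (sigma_ge0 Xs i) (lrhoB i) hc.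
have dotX := cauchy_schwarz_norm2 (A^T *m b) (vec Xs).
have AX0 : calA Xs = 0.
  apply: norm2_eq0; apply/eqP; rewrite -sqrf_eq0 eq_le sqr_ge0 andbT.
  by move: dotX; rewrite -/c; lra.
have PX0 : P a Xs = 0.
  apply/eqP; rewrite eq_le P_ge0 // andbT -(pmulr_rle0 _ hlambda).
  move: optE; rewrite -adjoint_dot -hA AX0.
  rewrite [X in 2 * X]big1 => [|i _]; last by rewrite mxE mul0r.
  by rewrite mulr0; apply: le_trans; rewrite lerDr sqr_ge0.
apply: vec_eq0; apply: norm2_eq0; apply/eqP; rewrite eq_le norm2_ge0 andbT.
apply: le_trans (norm2_vec_le_sum_sigma Xs) _; rewrite big1 // => i _.
have /psumr_eq0P rho0 := PX0.
have {}rho0 : rho a (sigma Xs 0 i) = 0 by apply: rho0 => // j _; exact: rho_ge0.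
apply/eqP; rewrite eq_le sigma_ge0 andbT -(pmulr_rle0 _ ha).
(* Taking lambda = 1 and B = 0 turns a vanishing [rho] into a * sigma_i <= 0. *)
have := @rho_le_bound _ a _ 1 0 ha (sigma_ge0 Xs i).
by rewrite rho0 mulr0 subr0 mulr1; apply.
Qed.
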